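(* Let $a\ge 1$ be an integer and define $\psi_a$ on rationals $\frac pq\in[0,\frac12]$ (in lowest terms, $q>0$) by $$\psi_a\left(\frac{p}{q}\right)=\frac1q\,\operatorname{arcosh}\left(\frac12\,X\left(\frac pq\right)\right),$$ where $X\left(\frac pq\right)$ is the $a$-Markov number corresponding to the Farey fraction $\frac pq$. Then the function $\psi_a$ can be extended to a continuous convex function of real $x\in[0,\frac12]$, which is differentiable at all irrational $x$ and not differentiable at rational $x$.
   Context: Fix an integer $a\ge1$. Consider the Diophantine equation $$X^2+Y^2+Z^2=XYZ+4-4a^6,$$ which has the solution $X=Y=a^2+2$, $Z=4a^2+2$. The set of solutions is preserved by permutations and by the Vieta involution $(X,Y,Z)\mapsto(X,Y,XY-Z)$. Applying these operations to the solution $(a^2+2,\,a^2+2,\,4a^2+2)$ gives a tree of integer solutions generalising the Markov tree. Its entries, the $a$-Markov numbers, are labelled by rationals in $[0,\frac12]$ via the Farey tree as follows. Rationals are written in lowest terms with positive denominator. The Farey mediant of $\frac{r}{s}$ and $\frac{t}{u}$ is $\frac{r}{s}\oplus\frac{t}{u}=\frac{r+t}{s+u}$. Every rational strictly between $0$ and $\frac12$ is obtained exactly once from $\frac01,\frac12$ by successively taking mediants of adjacent Farey fractions. Set $$X\left(\tfrac01\right)=a^2+2,\qquad X\left(\tfrac12\right)=4a^2+2,\qquad X\left(\tfrac13\right)=(a^2+2)(4a^2+2)-(a^2+2)=4a^4+9a^2+2,$$ and recursively, if $L=\frac rs<R=\frac tu$ are Farey neighbours in $[0,\frac12]$ (that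 is, $st-ru=1$) and $M=L\oplus R$, then $$X(L\oplus M)=X(L)X(M)-X(R),\qquad X(M\oplus R)=X(M)X(R)-X(L).$$ Thus $(X(L),X(M),X(R))$ is always a solution $(X,Y,Z)$ of the Diophantine equation $X^2+Y^2+Z^2=XYZ+4-4a^6$. For $a=1$ the numbers $X(\frac pq)$ are three times the usual Markov numbers. *)

(* Defs.v *)
From HB Require Import structures.
From mathcomp Require Import all_boot all_order all_algebra.
From mathcomp Require Import all_classical all_reals all_analysis.
From mathcomp Require Import zify ring lra.
Set Implicit Arguments. Unset Strict Implicit. Unset Printing Implicit Defensive.
Import Order.TTheory GRing.Theory Num.Theory.
Import numFieldNormedType.Exports.
Local Open Scope classical_set_scope.
Local Open Scope ring_scope.

Definition mediant (x y : rat) : rat :=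
  (numq x + numq y)%:Q / (denq x + denq y)%:Q.

(* x = r/s < y = t/u are Farey neighbours when s t - r u = 1. *)
Definition farey (x y : rat) : Prop :=
  denq x * numq y - numq x * denq y = 1.

(* Descent in the Farey tree to the rational x, from the neighbours l < r that
   carry xl = X(l), xm = X(mediant l r), xr = X(r). *)
Fixpoint markov_descent (fuel : nat) (l r : rat) (xl xm xr : int) (x : rat)
    : int :=
  if x == mediant l r then xm
  else if fuel is k.+1 then
    if x < mediant l r
    then markov_descent k l (mediant l r) xl (xl * xm - xr) xm x
    else markov_descent k (mediant l r) r xm (xm * xr - xl) xr x
  else 0.

(* X(x), for 0 <= x <= 1/2; junk elsewhere.  Denominators increase strictly
   along the tree, so the fuel denq x always suffices: see markov_recl and
   markov_recr below. *)
Definition markov (a : int) (x : rat) : int :=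
  if x == 0 then a ^+ 2 + 2
  else if x == 1 / 2 then 4 * a ^+ 2 + 2
  else markov_descent `|denq x|%N 0 (1 / 2)
         (a ^+ 2 + 2)
         ((a ^+ 2 + 2) * (4 * a ^+ 2 + 2) - (a ^+ 2 + 2))
         (4 * a ^+ 2 + 2) x.

Definition arcosh (R : realType) (x : R) : R := ln (x + Num.sqrt (x ^+ 2 - 1)).

Definition psi (R : realType) (a : int) (x : rat) : R :=
  ((denq x)%:~R)^-1 * arcosh ((markov a x)%:~R / 2).

(* Differentiability at x of a function of which only the values on D matter:
   the two-sided derivative, for which D has to be a neighbourhood of x.  In
   particular no function on a closed interval is differentiable, in this
   sense, at an endpoint. *)
Definition differentiable_in (R : realType) (D : set R) (f : R -> R) (x : R)
    : Prop :=
  D° x /\ derivable f x 1.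

Section arcosh_spec.
Variable R : realType.

Lemma arcosh_ge0 (x : R) : 1 <= x -> 0 <= arcosh x.
Proof.
move=> x1; apply: ln_ge0; apply: (le_trans x1).
by rewrite lerDl sqrtr_ge0.
Qed.

Lemma arcoshK (x : R) : 1 <= x ->
  (expR (arcosh x) + expR (- arcosh x)) / 2 = x.
Proof.
move=> x1; rewrite expRN /arcosh.
have s0 : 0 <= Num.sqrt (x ^+ 2 - 1) := sqrtr_ge0 _.
have s2 : Num.sqrt (x ^+ 2 - 1) ^+ 2 = x ^+ 2 - 1.
  by rewrite sqr_sqrtr // subr_ge0 expr_ge1 // (le_trans ler01).
set s := Num.sqrt _ in s0 s2 *.
have p : 0 < x + s by lra.
rewrite lnK ?posrE //.
have -> : (x + s)^-1 = x - s.
  apply: (mulfI (lt0r_neq0 p)); rewrite mulfV ?gt_eqF //.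
  have -> : (x + s) * (x - s) = x ^+ 2 - s ^+ 2 by ring.
  by rewrite s2; ring.
by field.
Qed.

End arcosh_spec.

Section farey_theory.

Lemma numden_frac (m n : int) (u v : int) : 0 < n -> u * m + v * n = 1 ->
  numq (m%:Q / n%:Q) = m /\ denq (m%:Q / n%:Q) = n.
Proof.
move=> n0 bez.
have cop : coprime `|m| `|n|.
  suff : coprimez m n by rewrite coprimezE.
  by apply/coprimezP; exists (u, v).
split; first by rewrite coprimeq_num // gtr0_sg // mul1r.
by rewrite coprimeq_den // gt_eqF // gtr0_norm.
Qed.

Lemma numden_mediant x y : farey x y ->
  numq (mediant x y) = numq x + numq y /\ denq (mediant x y) = denq x + denq y.
Proof.
rewrite /farey => h.
apply: (@numden_frac _ _ (denq x) (- numq x)).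
  by rewrite addr_gt0 ?denq_gt0.
by rewrite -[RHS]h; ring.
Qed.

Lemma farey_mediantl x y : farey x y -> farey x (mediant x y).
Proof.
move=> h; have [n d] := numden_mediant h.
by move: h; rewrite /farey n d => <-; ring.
Qed.

Lemma farey_mediantr x y : farey x y -> farey (mediant x y) y.
Proof.
move=> h; have [n d] := numden_mediant h.
by move: h; rewrite /farey n d => <-; ring.
Qed.

Lemma ltq_numden (x y : rat) : (x < y) = (numq x * denq y < numq y * denq x).
Proof. exact: lt_ratE. Qed.

Lemma leq_numden (x y : rat) : (x <= y) = (numq x * denq y <= numq y * denq x).
Proof. exact: le_ratE. Qed.

Lemma farey_lt x y : farey x y -> x < y.
Proof. by rewrite ltq_numden /farey; lia. Qed.

Lemma numden_half : numq (1 / 2) = 1 /\ denq (1 / 2) = 2.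
Proof. by split. Qed.

Lemma rat_numden (x y : rat) : numq x = numq y -> denq x = denq y -> x = y.
Proof. by move=> n d; rewrite -[x]divq_num_den -[y]divq_num_den n d. Qed.

(* Every pair of neighbours other than (0, 1/2) has a parent pair. *)
Lemma farey_parent l r : 0 <= l -> r <= 1 / 2 -> farey l r ->
  (l = 0 /\ r = 1 / 2) \/
  exists l' r', [/\ 0 <= l', r' <= 1 / 2, farey l' r' &
    (l = l' /\ r = mediant l' r') \/ (l = mediant l' r' /\ r = r')].
Proof.
have [nh dh] := numden_half.
rewrite !leq_numden nh dh /farey => l0 r1 h.
have {}l0 : 0 <= numq l by move: l0; rewrite (_ : numq 0 = 0) // (_ : denq 0 = 1) //; lia.
have dl : 0 < denq l := denq_gt0 l.
have dr : 0 < denq r := denq_gt0 r.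
have [lt|gt|eq] := ltrgtP (denq l) (denq r).
- have [big|small] := ltP (denq r - denq l) (2 * (numq r - numq l)).
    left.
    have nr : 0 < numq r by nia.
    have dr2 : denq r = 2 by nia.
    have nr1 : numq r = 1 by nia.
    have dl1 : denq l = 1 by nia.
    have nl0 : numq l = 0 by nia.
    by split; apply: rat_numden; rewrite ?nh ?dh.
  right; exists l, ((numq r - numq l)%:Q / (denq r - denq l)%:Q).
  have [n' d'] : numq ((numq r - numq l)%:Q / (denq r - denq l)%:Q)
      = numq r - numq l /\
      denq ((numq r - numq l)%:Q / (denq r - denq l)%:Q) = denq r - denq l.
    apply: (@numden_frac _ _ (denq l) (- numq l)); first by lia.
    by rewrite -[RHS]h; ring.
  have h' : farey l ((numq r - numq l)%:Q / (denq r - denq l)%:Q).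
    by rewrite /farey n' d' -[RHS]h; ring.
  have [n'' d''] := numden_mediant h'.
  split => //.
  + by rewrite leq_numden (_ : numq 0 = 0) // (_ : denq 0 = 1) //; lia.
  + by rewrite leq_numden n' d' nh dh; lia.
  + left; split => //; apply: rat_numden; rewrite ?n'' ?d'' ?n' ?d'; ring.
- right; exists ((numq l - numq r)%:Q / (denq l - denq r)%:Q), r.
  have [n' d'] : numq ((numq l - numq r)%:Q / (denq l - denq r)%:Q)
      = numq l - numq r /\
      denq ((numq l - numq r)%:Q / (denq l - denq r)%:Q) = denq l - denq r.
    apply: (@numden_frac _ _ (- denq r) (numq r)); first by lia.
    by rewrite -[RHS]h; ring.
  have h' : farey ((numq l - numq r)%:Q / (denq l - denq r)%:Q) r.
    by rewrite /farey n' d' -[RHS]h; ring.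
  have [n'' d''] := numden_mediant h'.
  split => //.
  + rewrite leq_numden n' d' (_ : numq 0 = 0) // (_ : denq 0 = 1) //.
    have nr : 0 < numq r by nia.
    have [//|lt] := leP (numq r) (numq l); first by lia.
    have : numq l * denq r <= (numq r - 1) * denq r by nia.
    have : (denq r + 1) * numq r <= denq l * numq r by nia.
    by nia.
  + by rewrite leq_numden nh dh; lia.
  + right; split => //; apply: rat_numden; rewrite ?n'' ?d'' ?n' ?d'; ring.
- exfalso; rewrite eq in h.
  have nr : 0 < numq r by nia.
  have [le|lt] := leP (numq r) (numq l).
    by have := ler_wpM2l (ltW dr) le; lia.
  have : denq r * (numq l + 1) <= denq r * numq r by nia.
  by nia.
Qed.

Variable a : int.

Inductive reach : nat -> rat -> rat -> int -> int -> int -> Prop :=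
| reach0 : reach 0 0 (1 / 2) (a ^+ 2 + 2)
    ((a ^+ 2 + 2) * (4 * a ^+ 2 + 2) - (a ^+ 2 + 2)) (4 * a ^+ 2 + 2)
| reachl d l r xl xm xr : reach d l r xl xm xr ->
    reach d.+1 l (mediant l r) xl (xl * xm - xr) xm
| reachr d l r xl xm xr : reach d l r xl xm xr ->
    reach d.+1 (mediant l r) r xm (xm * xr - xl) xr.

Lemma reach_farey d l r xl xm xr : reach d l r xl xm xr ->
  [/\ 0 <= l, r <= 1 / 2, farey l r & d%:Z + 3 <= denq l + denq r].
Proof.
elim=> {d l r xl xm xr} [|d l r xl xm xr _ [l0 r1 h b]|d l r xl xm xr _ [l0 r1 h b]].
- by [].
- have hl := farey_mediantl h; have hr := farey_mediantr h.
  split=> //; first by rewrite (le_trans _ r1) // ltW // farey_lt.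
  have [_ ->] := numden_mediant h; have := denq_gt0 l; lia.
- have hl := farey_mediantl h; have hr := farey_mediantr h.
  split=> //; first by rewrite (le_trans l0) // ltW // farey_lt.
  have [_ ->] := numden_mediant h; have := denq_gt0 r; lia.
Qed.

Lemma reach_descent d l r xl xm xr : reach d l r xl xm xr ->
  forall x k, l < x -> x < r ->
  markov_descent (d + k) 0 (1 / 2) (a ^+ 2 + 2)
    ((a ^+ 2 + 2) * (4 * a ^+ 2 + 2) - (a ^+ 2 + 2)) (4 * a ^+ 2 + 2) x
  = markov_descent k l r xl xm xr x.
Proof.
elim=> {d l r xl xm xr} // d l r xl xm xr re IH x k lx xr'.
- have [_ _ h _] := reach_farey re.
  have mr := farey_lt (farey_mediantr h).
  by rewrite addSnnS IH ?(lt_trans xr') //= (lt_eqF xr') xr'.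
- have [_ _ h _] := reach_farey re.
  have lm := farey_lt (farey_mediantl h).
  by rewrite addSnnS IH ?(lt_trans lm) //= (gt_eqF lx) ltNge (ltW lx).
Qed.

Lemma reach_mediant d l r xl xm xr : reach d l r xl xm xr ->
  markov a (mediant l r) = xm.
Proof.
move=> re; have [l0 r1 h b] := reach_farey re.
have lm := farey_lt (farey_mediantl h); have mr := farey_lt (farey_mediantr h).
rewrite /markov gt_eqF ?(le_lt_trans l0) // lt_eqF ?(lt_le_trans mr) //.
have [_ dm] := numden_mediant h.
have -> : `|denq (mediant l r)|%N = (d + (`|denq (mediant l r)| - d))%N.
  by rewrite dm; lia.
rewrite (reach_descent re) //.
by case: (_ - _)%N => [|k] /=; rewrite eqxx.
Qed.

Lemma reach_ends d l r xl xm xr : reach d l r xl xm xr ->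
  markov a l = xl /\ markov a r = xr.
Proof.
elim=> {d l r xl xm xr} [|d l r xl xm xr re [hl hr]|d l r xl xm xr re [hl hr]].
- by [].
- by split=> //; apply: reach_mediant re.
- by split=> //; apply: reach_mediant re.
Qed.

Lemma farey_reach l r : 0 <= l -> r <= 1 / 2 -> farey l r ->
  exists d xl xm xr, reach d l r xl xm xr.
Proof.
have [n] := ubnP `|(denq l + denq r)%R|%N.
elim: n l r => // n IH l r hn l0 r1 h.
have [[-> ->]|[l' [r' [l0' r1' h' e]]]] := farey_parent l0 r1 h.
  by do 4 eexists; exact: reach0.
have [_ dm] := numden_mediant h'.
have [d [xl [xm [xr re]]]] : exists d xl xm xr, reach d l' r' xl xm xr.
  apply: IH => //.
  have p := denq_gt0 l'; have q := denq_gt0 r'.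
  by case: e hn => -[-> ->]; rewrite dm; lia.
case: e => -[-> ->]; do 4 eexists; [exact: reachl re|exact: reachr re].
Qed.

Lemma markov0 : markov a 0 = a ^+ 2 + 2.
Proof. by []. Qed.

Lemma markov_half : markov a (1 / 2) = 4 * a ^+ 2 + 2.
Proof. by []. Qed.

Lemma markov_third : markov a (1 / 3) = 4 * a ^+ 4 + 9 * a ^+ 2 + 2.
Proof.
have -> : 1 / 3 = mediant 0 (1 / 2) by apply/eqP.
by rewrite (reach_mediant reach0); ring.
Qed.

Lemma markov_recl l r : 0 <= l -> r <= 1 / 2 -> farey l r ->
  markov a (mediant l (mediant l r))
  = markov a l * markov a (mediant l r) - markov a r.
Proof.
move=> l0 r1 h; have [d [xl [xm [xr re]]]] := farey_reach l0 r1 h.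
have [-> ->] := reach_ends re.
by rewrite (reach_mediant re) (reach_mediant (reachl re)).
Qed.

Lemma markov_recr l r : 0 <= l -> r <= 1 / 2 -> farey l r ->
  markov a (mediant (mediant l r) r)
  = markov a (mediant l r) * markov a r - markov a l.
Proof.
move=> l0 r1 h; have [d [xl [xm [xr re]]]] := farey_reach l0 r1 h.
have [-> ->] := reach_ends re.
by rewrite (reach_mediant re) (reach_mediant (reachr re)).
Qed.

End farey_theory.

(* Main.v *)
Require Import Defs.
From mathcomp Require Import all_boot all_order all_algebra.
From mathcomp Require Import all_classical all_reals all_analysis.
From mathcomp Require Import zify ring lra.
Set Implicit Arguments. Unset Strict Implicit. Unset Printing Implicit Defensive.
Import Order.TTheory GRing.Theory Num.Theory.
Import numFieldNormedType.Exports.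
Local Open Scope classical_set_scope.
Local Open Scope ring_scope.

(** Write [l(s) = arcosh (X(s) / 2)], so that [X(s)] is the trace of an element
    of translation length [2 l(s)].  Identify a fraction [p/q] with the integer
    vector [(q, p)]; then [l] plays the role of a norm on primitive vectors and
    [psi (p/q) = l(p/q) / q] is its restriction to the line [q = 1].

    Fix [u] and a Farey neighbour [w].  Along the vectors [w + n u] the numbers
    [X] obey a linear recursion with characteristic roots [e^l(u)] and
    [e^(-l(u))], hence [X(w + n u) = A e^(n l(u)) + B e^(-n l(u))].  So
    [l(w + n u) = n l(u) + ln A + o(1)]: the one-sided derivative of the norm at
    [u] in the direction [w] is [ln A].  The Markov-type equation is the quadratic
    invariant of this recursion and gives
    [A B = 1 + 4 a^6 / (X(u)^2 - 4)].  Everything follows from the fact that this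
    product exceeds 1, but only by an amount that decays with [u].

    - [A B >= 1] yields [ln A <= l(w)] ([log_amp_le_len]): a chord of [psi] from
      [u] to a neighbour on its right has slope at least the right derivative at
      [u], and on its left at most the left derivative.
    - [A B > 1], with the neighbours of [u] on both sides, yields
      [support_gap]: at every interior rational the right derivative strictly
      exceeds the left one.  This is both convexity at a vertex and the kink.
    - Any two rationals are joined by a chain of Farey neighbours
      ([farey_between]), so these local facts propagate to [support_chain]: a
      line of admissible slope through a point of the graph of [psi] stays below
      the graph.
    - As [A B - 1] is at most of order [X(u)^(-2)], for neighbours [u < w] the right
      derivative at [u] and the left derivative at [w] differ by at most
      [16 a^6 (1/q_u + 1/q_w)] ([tangent_jump]).  An irrational number lies between
      neighbours of arbitrarily large denominators ([irrational_neighbours]), which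
      squeezes its two one-sided derivatives together.

    The extension is the supremum of support lines, one for each rational, with
    bounded slopes.  Such a supremum is convex and Lipschitz for free, and agrees
    with [psi] on rationals by [support_chain]. *)

Local Notation markov := Defs.markov.

(** * Farey neighbours *)

(** Oriented area spanned by the integer vectors [(denominator, numerator)]. *)
Definition fdet (x y : rat) : int := denq x * numq y - numq x * denq y.

(** Neighbours regardless of their order, so that one argument serves for the
    left and for the right side of a fraction. *)
Definition adjacent (x y : rat) : Prop := fdet x y = 1 \/ fdet x y = -1.

Definition in_range (x : rat) : Prop := 0 <= x <= 1 / 2.

Lemma fdetC x y : fdet y x = - fdet x y.
Proof. by rewrite /fdet; ring. Qed.

Lemma adjacentC x y : adjacent x y -> adjacent y x.
Proof. by rewrite /adjacent (fdetC x y) => -[->|->]; [right|left]. Qed.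

Lemma lt_fdet x y : (x < y) = (0 < fdet x y).
Proof. by rewrite ltq_numden /fdet; lia. Qed.

Lemma mediantC x y : mediant x y = mediant y x.
Proof. by rewrite /mediant addrC [denq x + _]addrC. Qed.

Lemma numden_mediant_adj x y : adjacent x y ->
  numq (mediant x y) = numq x + numq y /\ denq (mediant x y) = denq x + denq y.
Proof.
case=> h; first exact: numden_mediant.
rewrite mediantC addrC [denq x + _]addrC; apply: numden_mediant.
by have := fdetC x y; rewrite h.
Qed.

Lemma fdet_mediant x y : adjacent x y -> fdet x (mediant x y) = fdet x y.
Proof. by move=> h; have [n d] := numden_mediant_adj h; rewrite /fdet n d; ring. Qed.

Lemma adjacent_mediant x y : adjacent x y -> adjacent x (mediant x y).
Proof. by move=> h; rewrite /adjacent fdet_mediant. Qed.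

Lemma in_range_mediant x y : adjacent x y -> in_range x -> in_range y ->
  in_range (mediant x y).
Proof.
move=> h /andP[x0 x1] /andP[y0 y1]; have [n d] := numden_mediant_adj h.
have [nh dh] := numden_half.
move: x0 y0; rewrite -!numq_ge0 => x0 y0.
move: x1 y1; rewrite !leq_numden nh dh => x1 y1.
apply/andP; split; first by rewrite -numq_ge0 n; lia.
by rewrite leq_numden nh dh n d; lia.
Qed.

Lemma frac_of_fdet (s : rat) (p q : int) : 0 < q ->
  denq s * p - numq s * q = 1 -> exists v, numq v = p /\ denq v = q.
Proof.
move=> q0 h; exists (p%:Q / q%:Q).
by apply: (@numden_frac _ _ (denq s) (- numq s)) => //; rewrite -[RHS]h; ring.
Qed.

Lemma numden_bezout (s : rat) : exists u v : int, u * numq s + v * denq s = 1.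
Proof.
have : coprimez (numq s) (denq s) by rewrite coprimezE; exact: coprime_num_den.
by move=> /coprimezP[[u v]] /= e; exists u, v.
Qed.

(** Among the neighbours of [s], which differ by multiples of [s], one can be
    chosen whose determinant with [t] is a residue modulo [fdet s t].  Iterating
    joins [s] to [t] by a chain of neighbours. *)
Lemma farey_between s t : s < t -> fdet s t <> 1 -> exists v,
  [/\ farey s v, 0 < fdet v t & fdet v t < fdet s t].
Proof.
rewrite lt_fdet => st st1.
have [x [y xy]] := numden_bezout s.
set D := fdet s t in st st1 *.
pose m := - x * numq t - y * denq t.
pose e := (m %% D)%Z.
have e_ge0 : 0 <= e by rewrite modz_ge0 // gt_eqF.
have eD : e < D by rewrite ltz_pmod.
pose k := - (m %/ D)%Z.
have ee : e = m + k * D by rewrite [m in RHS](divz_eq m D) /k; ring.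
pose p := y + k * numq s; pose q := - x + k * denq s.
have h1 : denq s * p - numq s * q = 1 by rewrite -[RHS]xy /p /q; ring.
have h2 : q * numq t - p * denq t = e by rewrite ee /m /p /q /D /fdet; ring.
(* As vectors, [D v = e s + t], which makes the denominator of [v] positive. *)
have h3 : D * q = e * denq s + denq t by rewrite -[denq t]mul1r -h1 -h2 /D /fdet; ring.
have q0 : 0 < q.
  have := denq_gt0 s; have := denq_gt0 t; nia.
have [v [vp vq]] := frac_of_fdet q0 h1.
exists v; rewrite /farey /fdet vp vq; split=> //; rewrite h2 //.
rewrite lt_neqAle e_ge0 andbT eq_sym; apply/eqP => e00.
(* If [e = 0] then [t = D v] is primitive, so [D = 1]. *)
have h4 : D * p = e * numq s + numq t by rewrite -[numq t]mul1r -h1 -h2 /D /fdet; ring.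
have [x' [y' xy']] := numden_bezout t.
have : D * (x' * p + y' * q) = 1.
  rewrite mulrDr ![D * (_ * _)]mulrCA h3 h4 e00 !mul0r !add0r -[RHS]xy'; ring.
set z := x' * p + y' * q => Dz.
have [z0|z0] := leP z 0.
  by have := mulr_ge0_le0 (ltW st) z0; rewrite Dz.
have D2 : 2 <= D by lia.
have := ler_pM (isT : 0 <= 2 :> int) (isT : 0 <= 1 :> int) D2 (z0 : 1 <= z).
by rewrite Dz.
Qed.

(** Descending from [0, 1/2] towards [s], the determinants of [s] with the two
    ends are positive and their sum strictly decreases until [s] is the
    mediant. *)
Lemma farey_parents s : 0 < s -> s < 1 / 2 -> exists l r,
  [/\ 0 <= l, r <= 1 / 2, farey l r & s = mediant l r].
Proof.
move=> s0 s1.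
suff : forall (n : nat) l r, (`|(fdet l s + fdet s r)%R| < n)%N -> 0 <= l -> r <= 1 / 2 ->
    farey l r -> l < s -> s < r ->
    exists l r, [/\ 0 <= l, r <= 1 / 2, farey l r & s = mediant l r].
  by move=> /(_ _ 0 (1 / 2) (leqnn _)); apply.
elim=> // n IH l r ln l0 r1 h; rewrite !lt_fdet => ls sr.
have [nm dm] := numden_mediant h.
have eM : fdet (mediant l r) s = fdet l s - fdet s r by rewrite /fdet nm dm; ring.
have el := farey_lt (farey_mediantl h); have er := farey_lt (farey_mediantr h).
have [lt|gt|eq] := ltrgtP s (mediant l r).
- apply: (IH l (mediant l r)) => //.
  + by rewrite (fdetC (mediant l r)) eM; lia.
  + by rewrite (le_trans _ r1) // ltW.
  + exact: farey_mediantl.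
  + by rewrite lt_fdet.
- apply: (IH (mediant l r) r) => //.
  + by rewrite eM; lia.
  + by rewrite (le_trans l0) // ltW.
  + exact: farey_mediantr.
  + by rewrite lt_fdet.
by exists l, r.
Qed.

Lemma numden_iter_mediant u w n : adjacent u w ->
  [/\ numq (iter n (mediant u) w) = numq w + n%:Z * numq u,
      denq (iter n (mediant u) w) = denq w + n%:Z * denq u &
      fdet u (iter n (mediant u) w) = fdet u w].
Proof.
move=> h; elim: n => [|n [IH1 IH2 IH3]] /=; first by rewrite !mul0r !addr0.
have h' : adjacent u (iter n (mediant u) w) by rewrite /adjacent IH3.
have [-> ->] := numden_mediant_adj h'; rewrite fdet_mediant // IH1 IH2 IH3.
by split=> //; lia.
Qed.

(** Consequently a quantity attached to [u] and [w] that is unchanged when [w] is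
    replaced by [mediant u w] depends on [w] only through its side of [u]. *)
Lemma adjacent_same_side u w w' : adjacent u w -> fdet u w' = fdet u w ->
  exists n, w' = iter n (mediant u) w \/ w = iter n (mediant u) w'.
Proof.
move=> h e.
have h' : adjacent u w' by rewrite /adjacent e.
have ee : fdet u w * fdet u w = 1 by case: h => ->.
(* As vectors, [w' = w + k u]. *)
pose k := fdet u w * fdet w' w.
have nE : numq w' = numq w + k * numq u.
  have id : fdet u w * numq w' = fdet u w' * numq w + fdet w' w * numq u.
    by rewrite /fdet; ring.
  by rewrite -[numq w']mul1r -ee -mulrA id e mulrDr mulrA ee mul1r /k mulrA.
have dE : denq w' = denq w + k * denq u.
  have id : fdet u w * denq w' = fdet u w' * denq w + fdet w' w * denq u.
    by rewrite /fdet; ring.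
  by rewrite -[denq w']mul1r -ee -mulrA id e mulrDr mulrA ee mul1r /k mulrA.
exists `|k|%N; have [k0|k0] := leP 0 k; [left|right].
  have [n1 d1 _] := numden_iter_mediant `|k|%N h.
  by apply: rat_numden; rewrite ?n1 ?d1 ?nE ?dE; nia.
have [n1 d1 _] := numden_iter_mediant `|k|%N h'.
by apply: rat_numden; rewrite ?n1 ?d1 ?nE ?dE; nia.
Qed.

(** * Size and quadratic invariant of the Markov numbers *)

Section integer_markov.
Variable a : int.
Hypothesis ha : 1 <= a.

(** All these bounds propagate together down the tree: since [X >= 3] at the ends,
    the recursion at least doubles the larger entry, and this doubling in turn
    keeps [X] above the denominators.  The equation is preserved because the
    recursion is the Vieta involution. *)
Lemma reach_markov d l r xl xm xr : reach a d l r xl xm xr ->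
  [/\ (3 <= xl /\ 3 <= xr), (2 * xl <= xm /\ 2 * xr <= xm),
      (denq l <= xl /\ denq r <= xr) &
      xl ^+ 2 + xm ^+ 2 + xr ^+ 2 = xl * xm * xr + 4 - 4 * a ^+ 6].
Proof.
elim=> {d l r xl xm xr} [|d l r xl xm xr re|d l r xl xm xr re].
- have a2 : 1 <= a ^+ 2 by rewrite expr2; nia.
  rewrite (_ : denq 0 = 1) // (_ : denq (1 / 2) = 2) //.
  by split; [split|split|split|ring]; nia.
- have [_ _ h _] := reach_farey re; have [_ ->] := numden_mediant h.
  move=> [[l3 r3] [lm rm] [dl dr] e]; split; [split; nia|split; nia|split; nia|].
  rewrite [LHS](_ : _ = xl ^+ 2 + xm ^+ 2 + xr ^+ 2 +
    xl * xm * (xl * xm - 2 * xr)); last by ring.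
  by rewrite e; ring.
- have [_ _ h _] := reach_farey re; have [_ ->] := numden_mediant h.
  move=> [[l3 r3] [lm rm] [dl dr] e]; split; [split; nia|split; nia|split; nia|].
  rewrite [LHS](_ : _ = xl ^+ 2 + xm ^+ 2 + xr ^+ 2 +
    xm * xr * (xm * xr - 2 * xl)); last by ring.
  by rewrite e; ring.
Qed.

Lemma markov_adjacent u w : in_range u -> in_range w -> adjacent u w ->
  [/\ 3 <= markov a u, 2 * markov a u <= markov a (mediant u w),
      2 * markov a w <= markov a (mediant u w), denq u <= markov a u &
      markov a u ^+ 2 + markov a (mediant u w) ^+ 2 + markov a w ^+ 2 =
        markov a u * markov a (mediant u w) * markov a w + 4 - 4 * a ^+ 6].
Proof.
move=> /andP[u0 u1] /andP[w0 w1] h.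
case: h => h.
- have [d [xl [xm [xr re]]]] := farey_reach a u0 w1 h.
  have [-> ->] := reach_ends re; rewrite (reach_mediant re).
  by have [[? ?] [? ?] [? ?] e] := reach_markov re.
- have {}h : farey w u by have := fdetC u w; rewrite h.
  have [d [xl [xm [xr re]]]] := farey_reach a w0 u1 h.
  have [-> ->] := reach_ends re; rewrite mediantC (reach_mediant re).
  have [[? ?] [? ?] [? ?] e] := reach_markov re; split=> //.
  rewrite [LHS](_ : _ = xl ^+ 2 + xm ^+ 2 + xr ^+ 2); last by ring.
  by rewrite e; ring.
Qed.

Lemma markov_mediant2 u w : in_range u -> in_range w -> adjacent u w ->
  markov a (mediant u (mediant u w)) =
    markov a u * markov a (mediant u w) - markov a w.
Proof.
move=> /andP[u0 u1] /andP[w0 w1] [] h; first exact: markov_recl.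
have {}h : farey w u by have := fdetC u w; rewrite h.
by rewrite mediantC [mediant u w]mediantC markov_recr // mulrC.
Qed.

End integer_markov.

(** * Two-term exponential sequences and arcosh *)

Section amplitude.
Variable R : realType.
Implicit Types z y l k : R.

Lemma lt1_add_inv z : 1 <= z -> 2 < z + z^-1 -> 1 < z.
Proof.
rewrite le_eqVlt => /orP[/eqP <-|//]; by rewrite invr1; lra.
Qed.

(** [z + 1/z = 2 cosh (ln z)] and [cosh] is increasing on the positive axis. *)
Lemma ln_le_arcosh z y : 0 < z -> z + z^-1 <= y -> ln z <= arcosh (y / 2).
Proof.
move=> z0 zy.
have zz : z * z^-1 = 1 by rewrite mulfV ?gt_eqF.
have zi : 0 < z^-1 by rewrite invr_gt0.
have z2 : 2 <= z + z^-1.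
  have h : z + z^-1 - 2 = (z - 1) ^+ 2 * z^-1 by field; rewrite gt_eqF.
  by rewrite -subr_ge0 h mulr_ge0 ?sqr_ge0 // ltW.
have y1 : 1 <= y / 2 by lra.
have K := arcoshK y1; have t0 := arcosh_ge0 y1.
set t := arcosh _ in K t0 *.
rewrite -[t]expRK ler_ln ?posrE ?expR_gt0 //.
have E1 : 1 <= expR t by rewrite -expR0 ler_expR.
rewrite expRN in K; set e := expR t in K E1 *.
have ee : e * e^-1 = 1 by rewrite mulfV // gt_eqF // (lt_le_trans ltr01).
have [//|ez] := leP z e.
have : (z - e) * (1 - z^-1 * e^-1) <= 0 by nra.
have h : z^-1 * e^-1 < 1.
  rewrite -invfM invf_lt1; last by nra.
  by nra.
by nra.
Qed.

(** The coefficient [A] of [l ^ n] in the sequence [A l ^ n + B l ^ - n] with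
    first two terms [y0] and [y1]. *)
Definition amp l y0 y1 : R := (y1 - y0 / l) / (l - l^-1).

Lemma inv_lt l : 1 < l -> l^-1 < l.
Proof. by move=> l1; apply: lt_trans (l1); rewrite invf_lt1 // (lt_trans ltr01). Qed.

Lemma amp_step l y0 y1 : 1 < l ->
  amp l y1 ((l + l^-1) * y1 - y0) = l * amp l y0 y1.
Proof.
move=> l1; have li := inv_lt l1.
have ll : l * l^-1 = 1 by rewrite mulfV // gt_eqF // (lt_trans ltr01).
rewrite /amp mulrA; congr (_ / _).
by rewrite mulrBr mulrCA ll; ring.
Qed.

(** The product [A B] is read off the quadratic invariant of the recursion. *)
Lemma amp_prod l y0 y1 k : 1 < l ->
  (l + l^-1) ^+ 2 + y1 ^+ 2 + y0 ^+ 2 = (l + l^-1) * y1 * y0 + 4 - k ->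
  amp l y0 y1 * (y0 - amp l y0 y1) = 1 + k / ((l + l^-1) ^+ 2 - 4).
Proof.
move=> l1 e; have li := inv_lt l1.
have l0 : l != 0 by rewrite gt_eqF // (lt_trans ltr01).
have ll : l * l^-1 = 1 by rewrite mulfV.
have -> : (l + l^-1) ^+ 2 - 4 = (l - l^-1) ^+ 2.
  by rewrite sqrrD sqrrB ll; ring.
have d0 : l - l^-1 != 0 by rewrite subr_eq0 gt_eqF.
have -> : k = (l + l^-1) * y1 * y0 + 4 - ((l + l^-1) ^+ 2 + y1 ^+ 2 + y0 ^+ 2).
  by rewrite e; ring.
rewrite /amp; move: (l^-1) ll d0 => i ll d0.
apply: (mulIf (expf_neq0 2 d0)).
rewrite [RHS]mulrDl divfK ?expf_neq0 //.
have -> : (y1 - y0 * i) / (l - i) * (y0 - (y1 - y0 * i) / (l - i)) * (l - i) ^+ 2 =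
  (y1 - y0 * i) * (y0 * (l - i) - (y1 - y0 * i)) by field.
by nra.
Qed.

(** A crude bound, but a bound away from 0 uniform in all neighbours is what
    turns the smallness of [A B - 1] into smallness of [arcosh (y0 / 2) - ln A]. *)
Lemma amp_ge1 l y0 y1 : 1 < l -> 2 * (l + l^-1) <= y1 -> 0 <= y0 -> 2 * y0 <= y1 ->
  1 <= amp l y0 y1.
Proof.
move=> l1 h y00 hy; have li := inv_lt l1.
have l0 : 0 < l by rewrite (lt_trans ltr01).
have i0 : 0 < l^-1 by rewrite invr_gt0.
rewrite /amp ler_pdivlMr ?subr_gt0 // mul1r.
have : l^-1 < 1 by rewrite invf_lt1.
by nra.
Qed.

(** Stability of the inversion of [2 cosh]: with [e = exp (arcosh (y / 2))], both
    [y = e + 1/e] and [y = z + (1 + k)/z] hold, and comparing them gives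
    [(e - z)(z e - 1) = k e]. *)
Lemma arcosh_sub_ln_le z y k : 1 <= z -> 0 <= k -> 3 <= y ->
  z * (y - z) = 1 + k -> arcosh (y / 2) - ln z <= 2 * k.
Proof.
move=> z1 k0 y3 zy.
have y1 : 1 <= y / 2 by lra.
have K := arcoshK y1; have t0 := arcosh_ge0 y1.
set t := arcosh _ in K t0 *.
have E1 : 1 <= expR t by rewrite -expR0 ler_expR.
rewrite expRN in K; set e := expR t in K E1 *.
have z0 : 0 < z by rewrite (lt_le_trans ltr01).
have e0 : 0 < e by rewrite (lt_le_trans ltr01).
have ei : e * e^-1 = 1 by rewrite mulfV // gt_eqF.
have zi : z * z^-1 = 1 by rewrite mulfV // gt_eqF.
have e2 : 2 <= e by nra.
have key : (e - z) * (z * e - 1) = k * e.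
  have -> : k = z * (y - z) - 1 by rewrite zy; ring.
  have -> : y = e + e^-1 by lra.
  by nra.
have h : e - z <= 2 * k.
  have [//|h] := leP (e - z) (2 * k).
  have : (2 * k) * (z * e - 1) < (e - z) * (z * e - 1) by rewrite ltr_pM2r //; nra.
  rewrite key => h'.
  have : 0 <= k * ((z - 1) * e) by rewrite mulr_ge0 // mulr_ge0 // ?subr_ge0 // ltW.
  have : 0 <= k * (e - 2) by rewrite mulr_ge0 // subr_ge0.
  by nra.
have -> : t - ln z = ln (e / z).
  by rewrite lnM ?posrE ?invr_gt0 // lnV ?posrE // expRK.
have ez0 : 0 < e / z by rewrite divr_gt0.
have := @le_ln1Dx _ (e / z - 1); rewrite [1 + _]addrC subrK => /(_ _)/le_trans.
apply; first by lra.
have -> : e / z - 1 = (e - z) / z by rewrite mulrBl divff // gt_eqF.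
rewrite ler_pdivrMr // (le_trans h) //.
by rewrite ler_peMr // mulr_ge0.
Qed.

End amplitude.

(** * Lengths and amplitudes *)

Definition den (R : realType) (x : rat) : R := (denq x)%:~R.

Section denominator.
Variable R : realType.

Lemma den_gt0 x : 0 < den R x.
Proof. by rewrite ltr0z denq_gt0. Qed.

Lemma den_ge1 x : 1 <= den R x.
Proof. by rewrite (_ : 1 = 1%:~R) // ler_int; have := denq_gt0 x; lia. Qed.

End denominator.

Section geometry.
Variables (R : realType) (a : int).
Local Notation den := (den R).
Hypothesis ha : 1 <= a.

Definition markovR (x : rat) : R := (markov a x)%:~R.
Definition len (x : rat) : R := arcosh (markovR x / 2).

(** Asymptotic constant of [len (w + n u) - n * len u]: the derivative of the
    norm [len] at [u] in the direction [w]. *)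
Definition log_amp (u w : rat) : R :=
  ln (amp (expR (len u)) (markovR w) (markovR (mediant u w))).

Section neighbours.
Variables u w : rat.
Hypotheses (ru : in_range u) (rw : in_range w) (uw : adjacent u w).

Lemma markovR_ge3 : 3 <= markovR u.
Proof.
by have [h _ _ _ _] := markov_adjacent ha ru rw uw; rewrite (ler_int _ 3).
Qed.

Lemma den_le_markovR : den u <= markovR u.
Proof. by have [_ _ _ h _] := markov_adjacent ha ru rw uw; rewrite ler_int. Qed.

Lemma markovR_mediantl : 2 * markovR u <= markovR (mediant u w).
Proof.
have [_ h _ _ _] := markov_adjacent ha ru rw uw.
by rewrite /markovR (_ : 2 = 2%:~R) // -intrM ler_int.
Qed.

Lemma markovR_mediantr : 2 * markovR w <= markovR (mediant u w).
Proof.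
have [_ _ h _ _] := markov_adjacent ha ru rw uw.
by rewrite /markovR (_ : 2 = 2%:~R) // -intrM ler_int.
Qed.

Lemma markovR_fricke : markovR u ^+ 2 + markovR (mediant u w) ^+ 2 + markovR w ^+ 2 =
  markovR u * markovR (mediant u w) * markovR w + 4 - 4 * a%:~R ^+ 6.
Proof.
have [_ _ _ _ e] := markov_adjacent ha ru rw uw.
have := congr1 (fun i : int => i%:~R : R) e.
by rewrite /markovR !(rmorphD, rmorphB, rmorphM, rmorphXn, rmorphN) /=.
Qed.

Lemma markovR_mediant2 :
  markovR (mediant u (mediant u w)) = markovR u * markovR (mediant u w) - markovR w.
Proof. by rewrite /markovR markov_mediant2 // rmorphB rmorphM. Qed.

Lemma half_markovR_ge1 : 1 <= markovR u / 2.
Proof. by have := markovR_ge3; lra. Qed.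

Lemma markovRE : expR (len u) + (expR (len u))^-1 = markovR u.
Proof. by have := arcoshK half_markovR_ge1; rewrite expRN -/(len u); lra. Qed.

Lemma expR_len_gt1 : 1 < expR (len u).
Proof.
apply: lt1_add_inv; last by rewrite markovRE; have := markovR_ge3; lra.
by rewrite -expR0 ler_expR arcosh_ge0 // half_markovR_ge1.
Qed.

End neighbours.

Lemma kappa_gt0 : 0 < 4 * a%:~R ^+ 6 :> R.
Proof. by rewrite mulr_gt0 // exprn_gt0 // ltr0z; lia. Qed.

Section neighbours2.
Variables u w : rat.
Hypotheses (ru : in_range u) (rw : in_range w) (uw : adjacent u w).

Let l1 := expR_len_gt1 ru rw uw.
Let u3 := markovR_ge3 ru rw uw.
Let w3 := markovR_ge3 rw ru (adjacentC uw).

Lemma amp_neighbour_ge1 :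
  1 <= amp (expR (len u)) (markovR w) (markovR (mediant u w)).
Proof.
apply: amp_ge1 => //; first by rewrite (markovRE ru rw uw) markovR_mediantl.
  by rewrite (le_trans _ w3).
exact: markovR_mediantr.
Qed.

Lemma amp_neighbour_prod (A := amp (expR (len u)) (markovR w) (markovR (mediant u w))) :
  A * (markovR w - A) = 1 + 4 * a%:~R ^+ 6 / (markovR u ^+ 2 - 4).
Proof.
have mu := markovRE ru rw uw.
by rewrite -[in RHS]mu; apply: amp_prod => //; rewrite mu; exact: markovR_fricke.
Qed.

Lemma markovR_sqr_gt4 : 0 < markovR u ^+ 2 - 4.
Proof. by have := u3; nra. Qed.

Lemma log_amp_mediant : log_amp u (mediant u w) = log_amp u w + len u.
Proof.
rewrite /log_amp markovR_mediant2 // -[X in X * _ - _](markovRE ru rw uw) amp_step //.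
have A0 := lt_le_trans ltr01 amp_neighbour_ge1.
by rewrite lnM ?posrE ?expR_gt0 // expRK addrC.
Qed.

(** Here [X(w) = A + B] with [A B >= 1], so [X(w) >= A + 1/A]. *)
Lemma log_amp_le_len : log_amp u w <= len w.
Proof.
have A0 := lt_le_trans ltr01 amp_neighbour_ge1.
apply: ln_le_arcosh => //.
have h := amp_neighbour_prod.
rewrite -lerBrDl -[_^-1]mulr1 ler_pdivrMl // h lerDl.
by rewrite divr_ge0 // ltW // ?kappa_gt0 ?markovR_sqr_gt4.
Qed.

(** The defect in [log_amp_le_len] is controlled by [A B - 1], which is of order
    [X(u)^(-2)] and hence of order [den u ^ -2]. *)
Lemma len_sub_log_amp_le :
  den u * (len w - log_amp u w) <= 16 * a%:~R ^+ 6 / den u.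
Proof.
have d0 := den_gt0 R u; have dm := den_le_markovR ru rw uw.
have k0 := kappa_gt0; have m0 := markovR_sqr_gt4.
have h := arcosh_sub_ln_le amp_neighbour_ge1
  (divr_ge0 (ltW k0) (ltW m0)) w3 amp_neighbour_prod.
rewrite -/(len w) -/(log_amp u w) in h.
rewrite ler_pdivlMr // mulrAC -expr2.
apply: le_trans (ler_wpM2l (sqr_ge0 _) h) _.
rewrite 2!mulrA ler_pdivrMr //.
have h2 : 0 <= 2 * markovR u ^+ 2 - 8 - den u ^+ 2 by have := u3; nra.
by have := mulr_ge0 (ltW k0) h2; lra.
Qed.

End neighbours2.

(** The vectors [r] and [- l = r - s] belong to one and the same sequence
    [r + n s]; so if [r] has amplitude [A] and reverse amplitude [B], then [l] has
    amplitude [B e^(len s)], and the claim is [A B > 1]. *)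
Lemma log_amp_parents l r : in_range l -> in_range r -> adjacent l r ->
  len (mediant l r) < log_amp (mediant l r) l + log_amp (mediant l r) r.
Proof.
move=> rl rr lr.
have rs := in_range_mediant lr rl rr; have sl := adjacentC (adjacent_mediant lr).
have sr := adjacentC (adjacent_mediant (adjacentC lr)); rewrite mediantC in sr.
have l1 := expR_len_gt1 rs rl sl.
have Al := lt_le_trans ltr01 (amp_neighbour_ge1 rs rl sl).
have Ar := lt_le_trans ltr01 (amp_neighbour_ge1 rs rr sr).
have m0 := markovR_sqr_gt4 rs rl sl; have k0 := kappa_gt0.
have fr := markovR_fricke rl rr lr.
have AA := mulr_gt0 Al Ar.
rewrite /log_amp -lnM ?posrE // -[X in X < _]expRK ltr_ln ?posrE ?expR_gt0 // {AA}.
have mE := markovRE rs rl sl.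
have -> : markovR (mediant (mediant l r) r) = markovR (mediant l r) * markovR r - markovR l.
  rewrite mediantC [mediant l r]mediantC markovR_mediant2 //; last exact: adjacentC.
  by rewrite mulrC.
have -> : markovR (mediant (mediant l r) l) = markovR (mediant l r) * markovR l - markovR r.
  by rewrite mediantC markovR_mediant2 // mulrC.
rewrite -mE in fr m0 *; set e := expR _ in l1 fr m0 *.
have e0 : 0 < e by rewrite (lt_trans ltr01).
have ei := inv_lt l1.
have ee : e * e^-1 = 1 by rewrite mulfV // gt_eqF.
have d0 : 0 < e - e^-1 by rewrite subr_gt0.
rewrite /amp mulrACA -invfM ltr_pdivlMr ?mulr_gt0 //.
have -> : (e + e^-1) * markovR l - markovR r - markovR l / e = e * markovR l - markovR r by ring.
have -> : (e + e^-1) * markovR r - markovR l - markovR r / e = e * markovR r - markovR l by ring.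
have -> : (e * markovR l - markovR r) * (e * markovR r - markovR l) =
  e * ((e + e^-1) ^+ 2 - 4 + 4 * a%:~R ^+ 6).
  have -> : (e * markovR l - markovR r) * (e * markovR r - markovR l) =
      e * ((e + e^-1) * markovR l * markovR r - markovR l ^+ 2 - markovR r ^+ 2) +
      (1 - e * e^-1) * (markovR l * markovR r) by ring.
  by rewrite ee subrr mul0r addr0; congr (e * _); lra.
rewrite ltr_pM2l //.
have -> : (e + e^-1) ^+ 2 = (e - e^-1) * (e - e^-1) + 4 * (e * e^-1) by ring.
by rewrite ee; lra.
Qed.

End geometry.

(** * Chord slopes and support slopes on the rationals *)

Section slopes.
Variables (R : realType) (a : int).
Hypothesis ha : 1 <= a.
Local Notation len := (len R a).
Local Notation den := (den R).
Local Notation log_amp := (log_amp R a).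
Local Notation psi := (psi R a).
Local Notation toR := (@ratr R).

(** For Farey neighbours this is the slope of the chord of [psi], see
    [psi_slope]; the determinant 1 absorbs the denominators. *)
Definition slope (u w : rat) : R := den u * len w - den w * len u.

(** Limit of [slope u (w + n u)]: the right derivative of [psi] at [u] if [u < w],
    and the opposite of its left derivative if [w < u]. *)
Definition tangent (u w : rat) : R := den u * log_amp u w - den w * len u.

Lemma ratr_den x : toR x * den x = (numq x)%:~R.
Proof. by rewrite /ratr divfK // intr_eq0 denq_neq0. Qed.

Lemma sub_ratr u w : (toR w - toR u) * (den u * den w) = (fdet u w)%:~R.
Proof.
rewrite /fdet rmorphB !rmorphM /= -!ratr_den -!/(den _); ring.
Qed.

Lemma psiE x : psi x * den x = len x.
Proof. by rewrite /psi -/(den x) mulrAC mulVf ?mul1r // gt_eqF // den_gt0. Qed.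

Lemma psi_slope u w : farey u w -> psi w - psi u = slope u w * (toR w - toR u).
Proof.
move=> h; have dd : den u * den w != 0 by rewrite gt_eqF // mulr_gt0 // den_gt0.
apply: (mulIf dd); rewrite -mulrA sub_ratr [fdet u w]h mulr1 /slope -!psiE; ring.
Qed.

Lemma slopeC u w : slope w u = - slope u w.
Proof. by rewrite /slope opprB. Qed.

Lemma tangent_le_slope u w : in_range u -> in_range w -> adjacent u w ->
  tangent u w <= slope u w.
Proof.
by move=> ru rw uw; rewrite lerD2r ler_pM2l ?den_gt0 // log_amp_le_len.
Qed.

(** Both terms of the definition change by [den u * len u]. *)
Lemma tangent_mediant u w : in_range u -> in_range w -> adjacent u w ->
  tangent u (mediant u w) = tangent u w.
Proof.
move=> ru rw uw; rewrite /tangent log_amp_mediant //.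
have [_ d] := numden_mediant_adj uw; rewrite /den d rmorphD /=; ring.
Qed.

Lemma in_range_iter_mediant u w n : in_range u -> in_range w -> adjacent u w ->
  in_range (iter n (mediant u) w).
Proof.
move=> ru rw uw; elim: n => //= n IH; apply: in_range_mediant => //.
by have [_ _ h] := numden_iter_mediant n uw; rewrite /adjacent h.
Qed.

Lemma tangent_iter_mediant u w n : in_range u -> in_range w -> adjacent u w ->
  tangent u (iter n (mediant u) w) = tangent u w.
Proof.
move=> ru rw uw; elim: n => //= n <-; apply: tangent_mediant => //.
  exact: in_range_iter_mediant.
by have [_ _ h] := numden_iter_mediant n uw; rewrite /adjacent h.
Qed.

Lemma tangent_same_side u w w' : in_range u -> in_range w -> in_range w' ->
  adjacent u w -> fdet u w' = fdet u w -> tangent u w' = tangent u w.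
Proof.
move=> ru rw rw' uw e; have uw' : adjacent u w' by rewrite /adjacent e.
by have [n [->|->]] := adjacent_same_side uw e; rewrite tangent_iter_mediant.
Qed.

Definition right_support (s : rat) (m : R) :=
  forall r, in_range r -> farey s r -> m <= slope s r.

Definition left_support (s : rat) (m : R) :=
  forall l, in_range l -> farey l s -> slope l s <= m.

Lemma right_support_tangent u w : in_range u -> in_range w -> farey u w ->
  right_support u (tangent u w).
Proof.
move=> ru rw uw r r_in ur.
rewrite -(@tangent_same_side u w r) //; last by rewrite [RHS]uw.
  by apply: tangent_le_slope => //; left.
by left.
Qed.

Lemma left_support_tangent u w : in_range u -> in_range w -> farey w u ->
  left_support u (- tangent u w).
Proof.
move=> ru rw wu l rl lu; rewrite slopeC lerN2.
have ew : fdet u w = -1 by rewrite fdetC [fdet w u]wu.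
have el : fdet u l = -1 by rewrite fdetC [fdet l u]lu.
rewrite -(@tangent_same_side u w l) //; last by rewrite ew.
  by apply: tangent_le_slope => //; right.
by right.
Qed.

Lemma in_range0 : in_range 0. Proof. by []. Qed.
Lemma in_range_half : in_range (1 / 2). Proof. by []. Qed.

(** The difference of the two slopes is
    [den s * (log_amp s l + log_amp s r - len s)], with [l] and [r] the parents of
    [s]. *)
Lemma support_gap s : 0 < s -> s < 1 / 2 ->
  exists m1 m2, [/\ m1 < m2, left_support s m1 & right_support s m2].
Proof.
move=> s0 s1; have [l [r [l0 r1 lr e]]] := farey_parents s0 s1.
have lt_lr := farey_lt lr.
have rl : in_range l by rewrite /in_range l0 (le_trans (ltW lt_lr)).
have r_r : in_range r by rewrite /in_range r1 (le_trans l0 (ltW lt_lr)).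
have rs : in_range s by rewrite /in_range !ltW.
exists (- tangent s l), (tangent s r); split.
- have := log_amp_parents R ha rl r_r (or_introl lr).
  rewrite -e => h; rewrite -subr_gt0 opprK.
  have [_ d] := numden_mediant lr.
  have -> : tangent s r + tangent s l = den s * (log_amp s l + log_amp s r - len s).
    have ds : den s = den l + den r by rewrite /den e d rmorphD.
    by rewrite /tangent; have := congr1 ( *%R^~ (len s)) ds; rewrite /= => ?; lra.
  by rewrite mulr_gt0 ?den_gt0 // subr_gt0.
- by apply: left_support_tangent => //; rewrite e; exact: farey_mediantl.
- by apply: right_support_tangent => //; rewrite e; exact: farey_mediantr.
Qed.

Lemma ex_support s : in_range s ->
  exists m, left_support s m /\ right_support s m.
Proof.
move=> /andP[]; rewrite le_eqVlt => /orP[/eqP <- _|s0].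
  exists (tangent 0 (1 / 2)); split; last exact: right_support_tangent.
  move=> l /andP[l0 _] /farey_lt; by rewrite ltNge l0.
rewrite le_eqVlt => /orP[/eqP ->|s1].
  exists (- tangent (1 / 2) 0); split; first exact: left_support_tangent.
  move=> r /andP[_ r1] /farey_lt; by rewrite ltNge r1.
have [m1 [m2 [m12 h1 h2]]] := support_gap s0 s1.
exists m1; split=> // r r_in sr; exact: (le_trans (ltW m12) (h2 r r_in sr)).
Qed.

(** Along a chain of neighbours the chord slopes increase, since at each
    intermediate vertex [v] a support slope separates the chords on its left from
    those on its right.  The induction inserts one such [v]. *)
Lemma support_chain s t : in_range s -> in_range t -> s < t ->
  (forall m, right_support s m -> m * (toR t - toR s) <= psi t - psi s) /\
  (forall m, left_support t m -> psi t - psi s <= m * (toR t - toR s)).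
Proof.
have [n] := ubnP `|fdet s t|%N.
elim: n s t => // n IH s t ltn rs rt st.
have st0 : 0 < toR t - toR s by rewrite subr_gt0 ltr_rat.
have [e|/eqP e] := eqVneq (fdet s t) 1.
  rewrite (psi_slope e); split=> m hm; rewrite ler_pM2r //; exact: hm.
have [v [sv vt lt]] := farey_between st e.
have s_v := farey_lt sv; have v_t : v < t by rewrite lt_fdet.
have rv : in_range v.
  have [/andP[s0 _] /andP[_ t1]] := (rs, rt).
  by rewrite /in_range (le_trans s0 (ltW s_v)) (le_trans (ltW v_t) t1).
have [|h1 h2] := IH v t _ rv rt v_t; first by lia.
have vs0 : 0 < toR v - toR s by rewrite subr_gt0 ltr_rat.
have tv0 : 0 < toR t - toR v by rewrite subr_gt0 ltr_rat.
have [m' [lm rm]] := ex_support rv.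
have h3 := h1 _ rm; have h4 := lm _ rs sv; have h5 := psi_slope sv.
split=> m hm.
  have h6 := hm _ rv sv.
  have : (m' - m) * (toR t - toR v) >= 0.
    by apply: mulr_ge0 (ltW tv0); rewrite subr_ge0 (le_trans h6).
  have : (slope s v - m) * (toR v - toR s) >= 0.
    by apply: mulr_ge0 (ltW vs0); rewrite subr_ge0.
  lra.
have h6 := h2 _ hm.
have h7 : m' <= m by rewrite -(ler_pM2r tv0) (le_trans h3).
have : (m - slope s v) * (toR v - toR s) >= 0.
  by apply: mulr_ge0 (ltW vs0); rewrite subr_ge0 (le_trans h4).
lra.
Qed.

Lemma support_mono s t m m' : in_range s -> in_range t -> s < t ->
  right_support s m -> left_support t m' -> m <= m'.
Proof.
move=> rs rt st hm hm'; have [h1 h2] := support_chain rs rt st.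
have st0 : 0 < toR t - toR s by rewrite subr_gt0 ltr_rat.
by rewrite -(ler_pM2r st0) (le_trans (h1 _ hm)) // h2.
Qed.

(** [- tangent w u - tangent u w] splits exactly into the two defects
    [den u * (len w - log_amp u w)] and [den w * (len u - log_amp w u)]. *)
Lemma tangent_jump u w : in_range u -> in_range w -> adjacent u w ->
  - tangent w u - tangent u w <= 16 * a%:~R ^+ 6 * ((den u)^-1 + (den w)^-1).
Proof.
move=> ru rw uw.
have := len_sub_log_amp_le R ha ru rw uw.
have := len_sub_log_amp_le R ha rw ru (adjacentC uw).
rewrite /tangent mulrDr; lra.
Qed.

End slopes.

(** * Approximation of irrationals by neighbours; real differentiation *)

Section approximation.
Variable R : realType.
Local Notation toR := (@ratr R).
Local Notation den := (den R).

(** The intervals between [u] and [w + n u] shrink to [u], so [x] must leave them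
    for some [n]; it then lies between the consecutive mediants [w + (n + 1) u]
    and [w + n u].  Stated without order so as to improve either end. *)
Lemma between_step (u w : rat) (x : R) : irrational x ->
  in_range u -> in_range w -> adjacent u w -> (x - toR u) * (x - toR w) < 0 ->
  exists u' w', [/\ in_range u' /\ in_range w', adjacent u' w',
    (x - toR u') * (x - toR w') < 0, denq u < denq u' & denq w <= denq w'].
Proof.
move=> irr ru rw uw; apply: contraPP => no.
pose v n := iter n (mediant u) w.
have vP n : [/\ in_range (v n), denq (v n) = denq w + n%:Z * denq u,
    adjacent u (v n) & fdet u (v n) = fdet u w].
  have [_ d f] := numden_iter_mediant n uw.
  by split=> //; [exact: in_range_iter_mediant|rewrite /adjacent f].
suff bet n : (x - toR u) * (x - toR w) < 0 -> (x - toR u) * (x - toR (v n)) < 0.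
  move=> lt0.
  have y0 : 0 < `|x - toR u|.
    by rewrite normr_gt0; apply: contraTneq lt0 => ->; rewrite mul0r ltxx.
  pose n := Num.truncn (`|x - toR u|^-1); have {}bet := bet n.+1 lt0.
  have [_ d uv f] := vP n.+1.
  have dn : n.+1%:R <= den (v n.+1).
    rewrite (_ : n.+1%:R = n.+1%:~R) // ler_int d.
    by have := denq_gt0 u; have := denq_gt0 w; nia.
  have := truncnS_gt (`|x - toR u|^-1); rewrite -/n => lt_n.
  have du := den_ge1 R u.
  have nn : `|toR (v n.+1) - toR u| * (den u * den (v n.+1)) = 1.
    have du0 := den_gt0 R u; have dv0 := den_gt0 R (v n.+1).
    rewrite -[X in _ * X]ger0_norm ?mulr_ge0 ?ltW // -normrM sub_ratr f.
    by case: uw => ->; rewrite ?normrN normr1.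
  have lt_norm : `|x - toR u| <= `|toR (v n.+1) - toR u|.
    have [p|p] := leP (toR u) x.
      have : toR u < x by rewrite lt_neqAle p andbT -subr_eq0 -normr_eq0 gt_eqF // distrC.
      rewrite ger0_norm ?subr_ge0 //.
      rewrite -subr_gt0 => xu; move: bet; rewrite pmulr_rlt0 // => bet.
      by rewrite ger0_norm; lra.
    rewrite ltr0_norm ?subr_lt0 //; rewrite -subr_lt0 in p.
    move: bet; rewrite nmulr_rlt0 // => bet.
    by rewrite ltr0_norm; lra.
  have : 1 < `|x - toR u| * n.+1%:R by rewrite -ltr_pdivrMl // mulr1.
  have : `|x - toR u| * n.+1%:R <= `|toR (v n.+1) - toR u| * den (v n.+1).
    by apply: ler_pM => //; rewrite normr_ge0.
  have : `|toR (v n.+1) - toR u| * den (v n.+1) <= `|toR (v n.+1) - toR u| * (den u * den (v n.+1)).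
    by rewrite ler_wpM2l // ler_peMl // ltW // den_gt0.
  rewrite nn; lra.
elim: n => // n IH /IH {}IH.
have [rv d uv f] := vP n; have [rv1 d1 uv1 f1] := vP n.+1.
have [//|ge0] := ltP ((x - toR u) * (x - toR (v n.+1))) 0.
case: no; exists (v n.+1), (v n); split=> //.
- by rewrite /= mediantC; apply/adjacentC/adjacent_mediant/adjacentC.
- have ne q : x - toR q != 0 by rewrite subr_eq0; apply: contra_notN irr => /eqP ->; exists q.
  have {}ge0 : 0 < (x - toR u) * (x - toR (v n.+1)).
    by rewrite lt_neqAle ge0 andbT eq_sym mulf_neq0.
  have [p|p|/eqP p] := ltgtP (x - toR u) 0; last by rewrite (negPf (ne u)) in p.
    by move: ge0 IH; rewrite nmulr_rgt0 // nmulr_rlt0 // => ? ?; rewrite nmulr_rlt0.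
  by move: ge0 IH; rewrite pmulr_rgt0 // pmulr_rlt0 // => ? ?; rewrite pmulr_rlt0.
- by rewrite d1; have := denq_gt0 u; have := denq_gt0 w; nia.
- by rewrite d; have := denq_gt0 u; nia.
Qed.

Lemma ratr_half : toR (1 / 2) = 1 / 2.
Proof. by rewrite fmorph_div /= rmorph1 ratr_nat. Qed.

Lemma irrational_neighbours (x : R) (N : nat) : irrational x ->
  0 <= x <= 1 / 2 -> exists u w, [/\ in_range u /\ in_range w, farey u w,
    toR u < x /\ x < toR w & N%:R <= den u /\ N%:R <= den w].
Proof.
move=> irr /andP[x0 x1].
have ne q : x != toR q by apply: contra_notN irr => /eqP ->; exists q.
suff [u [w [[ru rw] uw bet [Nu Nw]]]] : exists u w, [/\ in_range u /\ in_range w,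
    adjacent u w, (x - toR u) * (x - toR w) < 0 & N%:Z <= denq u /\ N%:Z <= denq w].
  have {}Nu : N%:R <= den u by rewrite (_ : N%:R = N%:Z%:~R) // ler_int.
  have {}Nw : N%:R <= den w by rewrite (_ : N%:R = N%:Z%:~R) // ler_int.
  have main p q : p < q -> (x - toR p) * (x - toR q) < 0 -> toR p < x /\ x < toR q.
    rewrite -(ltr_rat R) => pq h.
    split; rewrite ltNge; apply/negP => h'; nra.
  case: uw => e.
    by exists u, w; split=> //; apply: main => //; exact: farey_lt.
  have e' : farey w u by have := fdetC u w; rewrite e.
  by exists w, u; split=> //; apply: main; rewrite 1?mulrC //; exact: farey_lt.
elim: N => [|N [u [w [[ru rw] uw bet [Nu Nw]]]]].
  exists 0, (1 / 2); split=> //; first by left.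
  have x00 : 0 < x by rewrite lt_neqAle x0 andbT eq_sym -(rmorph0 toR) ne.
  have x11 : x < 1 / 2.
    by rewrite lt_neqAle x1 andbT; rewrite -ratr_half ne.
  rewrite rmorph0 ratr_half subr0 pmulr_rlt0 // subr_lt0 //.
have [u1 [w1 [[ru1 rw1] uw1 bet1 du1 dw1]]] := between_step irr ru rw uw bet.
rewrite mulrC in bet1.
have [w2 [u2 [[rw2 ru2] uw2 bet2 dw2 du2]]] := between_step irr rw1 ru1 (adjacentC uw1) bet1.
exists w2, u2; split=> //; split; lia.
Qed.
End approximation.

Section real_functions.
Variable R : realType.
Local Notation toR := (@ratr R).
Implicit Types (f : R -> R) (x y c m lo hi K : R).

Definition lipschitz_with K f := forall x y, f y <= f x + K * `|y - x|.

Lemma lipschitz_withN K f : lipschitz_with K f -> lipschitz_with K (fun x => - f x).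
Proof. by move=> h x y; have := h y x; rewrite distrC; lra. Qed.

Lemma growth_of_rat K f c lo hi : 0 <= K -> lipschitz_with K f ->
  (forall s t, lo < toR s -> s < t -> toR t < hi -> c * (toR t - toR s) <= f (toR t) - f (toR s)) ->
  forall x y, lo <= x -> x < y -> y <= hi -> c * (y - x) <= f y - f x.
Proof.
move=> K0 lip h x y lox xy yhi; rewrite leNgt; apply/negP => gap.
set d := c * (y - x) - (f y - f x).
have d0 : 0 < d by rewrite subr_gt0.
(* Rational points within [e] of [x] and [y] change both sides by at most
   [2 (K + |c|) e], less than the gap [d]. *)
pose M := 2 * (K + `|c|) + 1.
have c0 : 0 <= `|c| by [].
have M0 : 0 < M by rewrite /M; lra.
pose e := Num.min ((y - x) / 2) (d / M).
have e0 : 0 < e by rewrite lt_min !divr_gt0 // subr_gt0.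
have e1 : e <= (y - x) / 2 by rewrite ge_min lexx.
have e2 : e * M <= d by rewrite -ler_pdivlMr // ge_min lexx orbT.
have [s] := @rat_in_itvoo R x (x + e) ltac:(lra).
rewrite in_itv /= => /andP[s1 s2].
have [t] := @rat_in_itvoo R (y - e) y ltac:(lra).
rewrite in_itv /= => /andP[t1 t2].
have st : s < t by rewrite -(ltr_rat R); lra.
have := h s t (le_lt_trans lox s1) st (lt_le_trans t2 yhi).
have a1 := lip y (toR t); have a2 := lip (toR s) x.
rewrite ltr0_norm in a1; last by lra.
rewrite ltr0_norm in a2; last by lra.
have : c * ((toR s - x) + (y - toR t)) <= `|c| * ((toR s - x) + (y - toR t)).
  by apply: ler_wpM2r (ler_norm c); lra.
have : `|c| * ((toR s - x) + (y - toR t)) <= `|c| * (2 * e) by apply: ler_wpM2l => //; lra.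
have : K * ((toR s - x) + (y - toR t)) <= K * (2 * e) by apply: ler_wpM2l => //; lra.
rewrite /M in e2; rewrite /d in e2 d0; nra.
Qed.

Definition quotient f x h := h^-1 * (f (h + x) - f x).

Lemma derivableE f x :
  derivable f x 1 = cvg (quotient f x h @[h --> 0^']).
Proof.
rewrite /derivable.
suff -> : (fun h : R => h^-1 *: (f (h *: (1 : R) + x) - f x)) = quotient f x by [].
by apply/funext => h; rewrite /quotient /= /GRing.scale /= mulr1.
Qed.

(** The derivative is the supremum of the eventual lower bounds of the difference
    quotient. *)
Lemma derivable_of_slopes f x :
  (forall e, 0 < e -> exists m m' d, [/\ 0 < d, m' - m < e &
     forall h, h != 0 -> `|h| < d -> m <= quotient f x h /\ quotient f x h <= m']) ->
  derivable f x 1.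
Proof.
move=> H; rewrite derivableE.
pose S := [set m | exists2 d, 0 < d &
  forall h, h != 0 -> `|h| < d -> m <= quotient f x h].
have SP m m' d : 0 < d -> S m -> (forall h, h != 0 -> `|h| < d -> quotient f x h <= m') ->
    m <= m'.
  move=> d0 [d1 d10 h1] h2; pose h := Num.min d d1 / 2.
  have mm : 0 < Num.min d d1 by rewrite lt_min d0.
  have h0 : 0 < h by rewrite divr_gt0.
  have hm : h < Num.min d d1 by rewrite /h; lra.
  have hn : `|h| < Num.min d d1 by rewrite gtr0_norm.
  move: hn; rewrite lt_min => /andP[hd hd1].
  by apply: (le_trans (h1 h _ hd1)); [rewrite gt_eqF|apply: h2 => //; rewrite gt_eqF].
have [m0 [m0' [d0 [d00 _ h0]]]] := H 1 ltr01.
have supS : has_sup S.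
  split; first by exists m0, d0 => // h hn hd; have [] := h0 h hn hd.
  by exists m0' => m Sm; apply: (SP m m0' d0) => // h hn hd; have [] := h0 h hn hd.
apply/cvg_ex; exists (sup S); apply/cvgrPdist_lt => e e0.
have [m [m' [d [dp me hd]]]] := H e e0.
have Sm : S m by exists d => // h hn hh; have [] := hd h hn hh.
have le1 : m <= sup S by apply: ub_le_sup => //; case: supS.
have le2 : sup S <= m'.
  apply: ge_sup; first by case: supS.
  by move=> z Sz; apply: (SP z m' d) => // h hn hh; have [] := hd h hn hh.
near=> h.
have [|| q1 q2] := hd h.
- by near: h; exact: nbhs_dnbhs_neq.
- near: h; apply: dnbhs0_lt => //.
rewrite ltr_norml; apply/andP; split; lra.
Unshelve. all: by end_near. Qed.

Lemma not_derivable_of_kink f x m1 m2 d : m1 < m2 -> 0 < d ->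
  (forall h, 0 < h -> h < d -> m2 <= quotient f x h) ->
  (forall h, h < 0 -> - d < h -> quotient f x h <= m1) ->
  ~ derivable f x 1.
Proof.
move=> m12 d0 h2 h1; rewrite derivableE => /cvg_ex[/= D].
move=> /cvgrPdist_lt/(_ ((m2 - m1) / 2)) []; first by rewrite divr_gt0 // subr_gt0.
move=> e /= e0 he; pose h := Num.min d e / 2.
have mm : 0 < Num.min d e by rewrite lt_min d0.
have h0 : 0 < h by rewrite divr_gt0.
have hm : h < Num.min d e by rewrite /h; lra.
move: hm; rewrite lt_min => /andP[hd hde].
have a1 : `|D - quotient f x h| < (m2 - m1) / 2.
  apply: he; last by rewrite /= gt_eqF.
  by rewrite /ball_ /= sub0r normrN gtr0_norm.
have a2 : `|D - quotient f x (- h)| < (m2 - m1) / 2.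
  apply: he; last by rewrite /= oppr_eq0 gt_eqF.
  by rewrite /ball_ /= sub0r opprK gtr0_norm.
have b1 := h2 h h0 hd.
move: a1 a2; rewrite !ltr_norml => /andP[? ?] /andP[? ?].
have : quotient f x (- h) <= m1 by apply: h1; lra.
lra.
Qed.

End real_functions.

(** * The convex extension *)

Section extension.
Variables (R : realType) (a : int).
Hypothesis ha : 1 <= a.
Local Notation toR := (@ratr R).
Local Notation den := (den R).
Local Notation psi := (psi R a).
Local Notation tangent := (tangent R a).
Local Notation left_support := (@left_support R a).
Local Notation right_support := (@right_support R a).

(** The right support slope at 0 and the left support slope at 1/2 bound all
    interior ones.  At the two ends one of the support conditions is vacuous, and
    the choice of slope has to be made explicitly to stay bounded. *)
Lemma ex_bounded_supports : exists (mu : rat -> R) (K : R), forall s, in_range s ->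
  [/\ left_support s (mu s), right_support s (mu s) & `|mu s| <= K].
Proof.
have h01 : farey 0 (1 / 2) by [].
have r0 : right_support 0 (tangent 0 (1 / 2)) by apply: right_support_tangent.
have l1 : left_support (1 / 2) (- tangent (1 / 2) 0) by apply: left_support_tangent.
have mono01 := support_mono ha in_range0 in_range_half (isT : 0 < 1 / 2 :> rat) r0 l1.
have H (s : rat) : exists m, in_range s -> [/\ left_support s m, right_support s m,
    tangent 0 (1 / 2) <= m & m <= - tangent (1 / 2) 0].
  have [rs|?] := pselect (in_range s); last by exists 0.
  have [m [lm rm]] := ex_support R ha rs.
  have /andP[] := rs; rewrite le_eqVlt => /orP[/eqP e _|s0].
    exists (tangent 0 (1 / 2)) => _; split=> //; rewrite -e //.
    by move=> l /andP[l0 _] /farey_lt; rewrite ltNge l0.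
  rewrite le_eqVlt => /orP[/eqP e|s1].
    exists (- tangent (1 / 2) 0) => _; split=> //; rewrite e //.
    by move=> r /andP[_ r1] /farey_lt; rewrite ltNge r1.
  exists m => _; split=> //; first exact: (support_mono ha in_range0 rs s0 r0 lm).
  exact: (support_mono ha rs in_range_half s1 rm l1).
have [mu muP] := choice H.
exists mu, (`|tangent 0 (1 / 2)| + `|tangent (1 / 2) 0|) => s rs.
have [lm rm h1 h2] := muP s rs; split=> //.
have := ler_norm (- tangent 0 (1 / 2)); have := ler_norm (- tangent (1 / 2) 0).
rewrite !normrN => ? ?; have := normr_ge0 (tangent 0 (1 / 2)).
have := normr_ge0 (tangent (1 / 2) 0) => ? ?.
by rewrite ler_norml; apply/andP; split; lra.
Qed.

Definition envelope (mu : rat -> R) (x : R) : R :=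
  sup [set y | exists2 s, in_range s & y = psi s + mu s * (x - toR s)].

Section envelope_theory.
Variables (mu : rat -> R) (K : R).
Hypothesis muP : forall s, in_range s ->
  [/\ left_support s (mu s), right_support s (mu s) & `|mu s| <= K].
Local Notation f := (envelope mu).

Lemma line_le_psi s t : in_range s -> in_range t ->
  psi s + mu s * (toR t - toR s) <= psi t.
Proof.
move=> rs rt; have [ls rs' _] := muP rs; have [lt|lt|->] := ltgtP s t.
- by have [h _] := support_chain R ha rs rt lt; have := h _ rs'; lra.
- by have [_ h] := support_chain R ha rt rs lt; have := h _ ls; lra.
- by rewrite subrr mulr0 addr0.
Qed.

Lemma envelope_has_sup x :
  has_sup [set y | exists2 s, in_range s & y = psi s + mu s * (x - toR s)].
Proof.
split; first by eexists; exists 0; first exact: in_range0.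
exists (psi 0 + K * `|x|) => _ [s rs ->].
have [_ _ muK] := muP rs.
have := line_le_psi rs in_range0; rewrite rmorph0 => h.
have : mu s * x <= K * `|x|.
  by apply: le_trans (ler_norm _) _; rewrite normrM ler_wpM2r.
lra.
Qed.

Lemma line_le_envelope s x : in_range s -> psi s + mu s * (x - toR s) <= f x.
Proof. by move=> rs; apply: ub_le_sup; [case: (envelope_has_sup x)|exists s]. Qed.

Lemma envelope_le x y :
  (forall s, in_range s -> psi s + mu s * (x - toR s) <= y) -> f x <= y.
Proof.
move=> h; apply: ge_sup; first by case: (envelope_has_sup x).
by move=> _ [s rs ->]; exact: h.
Qed.

Lemma envelope_ratr t : in_range t -> f (toR t) = psi t.
Proof.
move=> rt; apply/le_anti/andP; split.
  by apply: envelope_le => s rs; exact: line_le_psi.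
by have := line_le_envelope (toR t) rt; rewrite subrr mulr0 addr0.
Qed.

Lemma envelope_lipschitz : lipschitz_with K f.
Proof.
move=> x y; apply: envelope_le => s rs; have [_ _ muK] := muP rs.
have := line_le_envelope x rs.
have : mu s * (y - x) <= K * `|y - x|.
  by apply: le_trans (ler_norm _) _; rewrite normrM ler_wpM2r.
lra.
Qed.

Lemma slope_bound_ge0 : 0 <= K.
Proof. by have [_ _] := muP in_range0; apply: le_trans. Qed.

Lemma envelope_convex (t x y : R) : 0 <= t <= 1 ->
  f (t * x + (1 - t) * y) <= t * f x + (1 - t) * f y.
Proof.
move=> /andP[t0 t1]; apply: envelope_le => s rs.
have h1 := ler_wpM2l t0 (line_le_envelope x rs).
have t1' : 0 <= 1 - t by rewrite subr_ge0.
have h2 := ler_wpM2l t1' (line_le_envelope y rs).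
lra.
Qed.

Lemma envelope_continuous : continuous f.
Proof.
move=> x; apply/cvgrPdist_lt => e e0.
have K0 := slope_bound_ge0; have K1 : 0 < K + 1 by lra.
have d0 : 0 < e / (K + 1) by rewrite divr_gt0.
near=> y.
have : `|x - y| < e / (K + 1) by near: y; exact: cvgr_dist_lt.
rewrite ltr_pdivlMr // => h.
have a1 := envelope_lipschitz x y; have a2 := envelope_lipschitz y x.
rewrite distrC in a1.
have : 0 <= `|x - y| by [].
rewrite ltr_norml => h0; apply/andP; split; lra.
Unshelve. all: by end_near. Qed.

Lemma in_range_ratr s : 0 <= toR s -> toR s <= 1 / 2 -> in_range s.
Proof.
by rewrite -(rmorph0 toR) -ratr_half !ler_rat => s0 s1; rewrite /in_range s0 s1.
Qed.

Lemma ratr_in_range s : in_range s -> 0 <= toR s /\ toR s <= 1 / 2.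
Proof.
by move=> /andP[s0 s1]; rewrite -(rmorph0 toR) -ratr_half !ler_rat.
Qed.

Lemma envelope_growth_ge u m x y : in_range u -> right_support u m ->
  toR u <= x -> x < y -> y <= 1 / 2 -> m * (y - x) <= f y - f x.
Proof.
move=> ru hm; apply: (growth_of_rat slope_bound_ge0 envelope_lipschitz).
move=> s t us st t1; have [u0 _] := ratr_in_range ru.
have st' : toR s < toR t by rewrite ltr_rat.
have rs : in_range s by apply: in_range_ratr; lra.
have rt : in_range t by apply: in_range_ratr; lra.
rewrite ltr_rat in us.
rewrite !envelope_ratr //.
have [ls rs' _] := muP rs.
have h := support_mono ha ru rs us hm ls.
have [h1 _] := support_chain R ha rs rt st.
by apply: le_trans (h1 _ rs'); rewrite ler_wpM2r // subr_ge0 ltW.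
Qed.

Lemma envelope_growth_le w m x y : in_range w -> left_support w m ->
  0 <= x -> x < y -> y <= toR w -> f y - f x <= m * (y - x).
Proof.
move=> rw hm x0 xy yw.
suff : - m * (y - x) <= (- f y) - (- f x) by lra.
move: x y x0 xy yw.
apply: (growth_of_rat slope_bound_ge0 (lipschitz_withN envelope_lipschitz)).
move=> s t us st t1; have [_ w1] := ratr_in_range rw.
have st' : toR s < toR t by rewrite ltr_rat.
have rs : in_range s by apply: in_range_ratr; lra.
have rt : in_range t by apply: in_range_ratr; lra.
rewrite ltr_rat in t1.
rewrite !envelope_ratr //.
have [_ rt' _] := muP rt.
have h := support_mono ha rt rw t1 rt' hm.
have [_ h1] := support_chain R ha rs rt st.
have [lt _ _] := muP rt; have := h1 _ lt.
have : mu t * (toR t - toR s) <= m * (toR t - toR s) by rewrite ler_wpM2r // subr_ge0 ltW.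
lra.
Qed.

Lemma envelope_derivable x : 0 <= x <= 1 / 2 -> irrational x -> derivable f x 1.
Proof.
move=> x01 irr; apply: derivable_of_slopes => e e0.
(* [N] makes the bound [2 C / N] of [tangent_jump] smaller than [e]. *)
pose C : R := 16 * a%:~R ^+ 6.
have C0 : 0 <= C by rewrite mulr_ge0 // exprn_ge0 // ler0z; lia.
pose N := (Num.truncn (2 * C / e)).+1.
have hN : 2 * C / e < N%:R by exact: truncnS_gt.
have N0 : 0 < N%:R :> R by rewrite ltr0n.
have [u [w [[ru rw] uw [ux xw] [Nu Nw]]]] := irrational_neighbours N irr x01.
have hm := right_support_tangent R ha ru rw uw.
have hm' := left_support_tangent R ha rw ru uw.
have jump := tangent_jump R ha ru rw (or_introl uw).
exists (tangent u w), (- tangent w u), (Num.min (x - toR u) (toR w - x)).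
split; first by rewrite lt_min !subr_gt0 ux.
  apply: le_lt_trans jump _; rewrite -/C.
  have : C * ((den u)^-1 + (den w)^-1) <= C * (N%:R^-1 + N%:R^-1).
    by apply: ler_wpM2l => //; apply: lerD; rewrite lef_pV2 ?posrE ?den_gt0.
  move=> /le_lt_trans; apply.
  have -> : C * (N%:R^-1 + N%:R^-1) = 2 * C / N%:R by ring.
  by rewrite ltr_pdivrMr // [e * _]mulrC -ltr_pdivrMr.
have [u0 _] := ratr_in_range ru; have [_ w1] := ratr_in_range rw.
move=> h h0; rewrite lt_min => /andP[h1 h2].
rewrite ltr_norml in h1; rewrite ltr_norml in h2.
have [hp|hn|e00] := ltgtP h 0; last by rewrite e00 eqxx in h0.
- have g1 := @envelope_growth_ge u _ (h + x) x ru hm ltac:(lra) ltac:(lra) ltac:(lra).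
  have g2 := @envelope_growth_le w _ (h + x) x rw hm' ltac:(lra) ltac:(lra) ltac:(lra).
  by rewrite /quotient mulrC ler_ndivlMr // ler_ndivrMr //; split; lra.
- have g1 := @envelope_growth_ge u _ x (h + x) ru hm ltac:(lra) ltac:(lra) ltac:(lra).
  have g2 := @envelope_growth_le w _ x (h + x) rw hm' ltac:(lra) ltac:(lra) ltac:(lra).
  by rewrite /quotient mulrC ler_pdivlMr // ler_pdivrMr //; split; lra.
Qed.

Lemma envelope_not_derivable s : 0 < s -> s < 1 / 2 -> ~ derivable f (toR s) 1.
Proof.
move=> s0 s1; have [m1 [m2 [m12 h1 h2]]] := support_gap R ha s0 s1.
have rs : in_range s by rewrite /in_range !ltW.
have s0' : 0 < toR s by rewrite -(rmorph0 toR) ltr_rat.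
have s1' : toR s < 1 / 2 by rewrite -ratr_half ltr_rat.
apply: (@not_derivable_of_kink _ f (toR s) m1 m2 (Num.min (toR s) (1 / 2 - toR s))) => //.
- by rewrite lt_min s0' subr_gt0.
- move=> h hp; rewrite lt_min => /andP[hs hs'].
  have g := @envelope_growth_ge s _ (toR s) (h + toR s) rs h2 ltac:(lra) ltac:(lra) ltac:(lra).
  by rewrite /quotient mulrC ler_pdivlMr //; lra.
- move=> h hn; rewrite ltrNl lt_min => /andP[hs hs'].
  have g := @envelope_growth_le s _ (h + toR s) (toR s) rs h1 ltac:(lra) ltac:(lra) ltac:(lra).
  by rewrite /quotient mulrC ler_ndivrMr //; lra.
Qed.

End envelope_theory.
End extension.

Theorem theorem3 (R : realType) (a : int) (ha : 1 <= a) :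
  exists f : R -> R,
    [/\ forall x : rat, 0 <= x <= 1 / 2 -> f (ratr x) = psi R a x,
        {within `[0, 1 / 2], continuous f},
        convex_function (`[0, 1 / 2]%classic : set R) f,
        forall x : R, 0 <= x <= 1 / 2 -> irrational x ->
          differentiable_in `[0, 1 / 2]%classic f x &
        forall x : R, 0 <= x <= 1 / 2 -> rational x ->
          ~ differentiable_in `[0, 1 / 2]%classic f x].
Proof.
have [mu [K muP]] := ex_bounded_supports R ha.
exists (envelope a mu); split.
- by move=> x hx; exact: (envelope_ratr ha muP).
- by apply: continuous_subspaceT => x; exact: (envelope_continuous ha muP).
- move=> t x y _ _; rewrite !convRE.
  by apply: (envelope_convex ha muP); rewrite ge0 le1.
- move=> x hx irr; split; last exact: (envelope_derivable ha muP).
  rewrite interior_itv /= in_itv /=.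
  have ne q : x != ratr q by apply: contra_notN irr => /eqP ->; exists q.
  case/andP: hx => x0 x1; rewrite !lt_neqAle x0 x1 !andbT eq_sym.
  by rewrite -(rmorph0 (@ratr R)) ne -ratr_half ne.
- move=> x _ [q _ <-] [].
  rewrite interior_itv /= in_itv /= -(rmorph0 (@ratr R)) -ratr_half !ltr_rat.
  by move=> /andP[q0 q1]; exact: (envelope_not_derivable ha muP).
Qed.
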